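(* Let $\mathcal{T}\in\mathbb{R}^{n_1\times n_2\times\cdots\times n_d}$ be a $d$th-order tensor and let its TR decomposition be given by $\mathcal{T}=\Re(\mathcal{Z}_1,\mathcal{Z}_2,\ldots,\mathcal{Z}_d)$. For $1\le k\le d-1$, define $\overleftarrow{\mathcal{T}}^{k}\in\mathbb{R}^{n_{k+1}\times\cdots\times n_d\times n_1\times\cdots\times n_k}$ as the version of $\mathcal{T}$ whose dimensions are circularly shifted by $k$, i.e. $\overleftarrow{T}^{k}(i_{k+1},\ldots,i_d,i_1,\ldots,i_k)=T(i_1,\ldots,i_d)$ for all indices. Then $$\overleftarrow{\mathcal{T}}^{k}=\Re(\mathcal{Z}_{k+1},\ldots,\mathcal{Z}_d,\mathcal{Z}_1,\ldots,\mathcal{Z}_k).$$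
   Context: Tensor ring (TR) decomposition: given cores $\mathcal{Z}_k\in\mathbb{R}^{r_k\times n_k\times r_{k+1}}$, $k=1,\ldots,d$, with $r_{d+1}=r_1$, the notation $\mathcal{T}=\Re(\mathcal{Z}_1,\ldots,\mathcal{Z}_d)$ means that $\mathcal{T}\in\mathbb{R}^{n_1\times\cdots\times n_d}$ and $$T(i_1,\ldots,i_d)=\mathrm{Tr}\{\mathbf{Z}_1(i_1)\mathbf{Z}_2(i_2)\cdots\mathbf{Z}_d(i_d)\}\quad\text{for all } 1\le i_k\le n_k,$$ where $T(i_1,\ldots,i_d)$ is the $(i_1,\ldots,i_d)$th entry of $\mathcal{T}$ and $\mathbf{Z}_k(i_k)\in\mathbb{R}^{r_k\times r_{k+1}}$ is the $i_k$th lateral slice of $\mathcal{Z}_k$, i.e. the matrix with entries $\mathcal{Z}_k(\alpha,i_k,\beta)$. The same notation applies to the cyclically shifted list of cores, with the correspondingly shifted dimensions: adjacent cores share a common dimension, and the last dimension of the last core equals the first dimension of the first core. *)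

(* Defs.v *)
From mathcomp Require Import all_boot all_order all_algebra.
From mathcomp Require Import reals.

Set Implicit Arguments.
Unset Strict Implicit.
Unset Printing Implicit Defensive.

Import GRing.Theory.
Local Open Scope ring_scope.

#[local] Arguments ordS {n}.
#[local] Arguments ord_pred {n}.

(* Modes are numbered from 0, and [ordS] is the cyclic successor on ['I_d],    *)
(* so that [iter k ordS j] is the mode [(j + k) %% d].                         *)

Lemma val_iter_ordS d k (j : 'I_d) : iter k ordS j = ((j + k) %% d)%N :> nat.
Proof.
elim: k => [|k IHk] /=; first by rewrite addn0 modn_small.
by rewrite IHk -addn1 modnDml addn1 addnS.
Qed.

Lemma iter_ordS_full d (j : 'I_d) : iter d ordS j = j.
Proof. by apply: val_inj; rewrite /= val_iter_ordS modnDr modn_small. Qed.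

Lemma iter_ord_predK d k :
  cancel (iter k (@ord_pred d)) (iter k (@ordS d)).
Proof.
elim: k => // k IHk j.
by rewrite iterSr [iter k.+1 ord_pred j]iterS ord_predK IHk.
Qed.

Lemma iter_ordSK d k :
  cancel (iter k (@ordS d)) (iter k (@ord_pred d)).
Proof.
elim: k => // k IHk j.
by rewrite iterSr [iter k.+1 ordS j]iterS ordSK IHk.
Qed.

Definition mindex d (n : 'I_d -> nat) := {dffun forall k : 'I_d, 'I_(n k)}.

Definition tensor (R : realType) d (n : 'I_d -> nat) := {ffun mindex n -> R}.

Definition core (R : realType) (p n q : nat) := 'I_p -> 'I_n -> 'I_q -> R.

Definition slice R p n q (Z : core R p n q) (i : 'I_n) : 'M[R]_(p, q) :=
  \matrix_(a, b) Z a i b.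

(* The closing condition on the ranks is built into the use of [ordS]:         *)
(* the last rank of the last core is the first rank of the first core.         *)
Definition cores (R : realType) d (r n : 'I_d -> nat) :=
  forall k : 'I_d, core R (r k) (n k) (r (ordS k)).

(* The product [M 0 *m M 1 *m ... *m M (m - 1)].                               *)
Fixpoint chain_mx (R : realType) d (r : 'I_d.+1 -> nat)
    (M : forall k, 'M[R]_(r k, r (ordS k))) (m : nat) :
    'M[R]_(r ord0, r (iter m ordS ord0)) :=
  if m is m'.+1 then chain_mx M m' *m M (iter m' ordS ord0) else 1%:M.

(* The cast only identifies the column index [r (iter d.+1 ordS ord0)] with    *)
(* [r ord0].                                                                   *)
Definition tensor_ring (R : realType) d (r n : 'I_d.+1 -> nat)
    (Z : cores R r n) : tensor R n :=
  [ffun i : mindex n =>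
    \tr (castmx (erefl, congr1 r (iter_ordS_full ord0))
                (chain_mx (fun k => slice (Z k) (i k)) d.+1))].

Definition cshift d (A : Type) (k : nat) (f : 'I_d -> A) : 'I_d -> A :=
  fun j => f (iter k ordS j).

Definition cshift_mindex d (n : 'I_d -> nat) k (i : mindex n) :
    mindex (cshift k n) :=
  [ffun j => i (iter k ordS j)].

Definition uncshift_mindex d (n : 'I_d -> nat) k (i : mindex (cshift k n)) :
    mindex n :=
  [ffun j => cast_ord (congr1 n (iter_ord_predK k j)) (i (iter k ord_pred j))].

Lemma cshift_mindexK d (n : 'I_d -> nat) k :
  cancel (@cshift_mindex d n k) (@uncshift_mindex d n k).
Proof.
move=> i; apply/ffunP => j; rewrite !ffunE; apply: val_inj => /=.
by rewrite iter_ord_predK.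
Qed.

Lemma uncshift_mindexK d (n : 'I_d -> nat) k :
  cancel (@uncshift_mindex d n k) (@cshift_mindex d n k).
Proof.
move=> i; apply/ffunP => j; rewrite !ffunE; apply: val_inj => /=.
by rewrite iter_ordSK.
Qed.

Definition cshift_tensor (R : realType) d (n : 'I_d -> nat) k (T : tensor R n) :
    tensor R (cshift k n) :=
  [ffun i => T (uncshift_mindex i)].

(* The equation that characterizes the shifted tensor.                         *)
Lemma cshift_tensorE (R : realType) d (n : 'I_d -> nat) k (T : tensor R n)
    (i : mindex n) :
  cshift_tensor k T (cshift_mindex k i) = T i.
Proof. by rewrite ffunE cshift_mindexK. Qed.

(* The core in position [j] is [Z (iter k ordS j)]; [cast_ord] only turns      *)
(* [r (iter k ordS (ordS j))] into [r (ordS (iter k ordS j))].                 *)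
Definition cshift_cores (R : realType) d (r n : 'I_d -> nat) k
    (Z : cores R r n) : cores R (cshift k r) (cshift k n) :=
  fun j a i b =>
    Z (iter k ordS j) a i (cast_ord (congr1 r (esym (iterSr k ordS j))) b).

Arguments cshift_cores {R d r n} k Z _ _ _ _.

(* Main.v *)
Require Import Defs.
From mathcomp Require Import all_boot all_order all_algebra.
From mathcomp Require Import reals.

(** The theorem is the cyclic invariance of the trace,
    [\tr (A *m B) = \tr (B *m A)], applied to the product of the slices. The
    slices are rectangular matrices whose sizes depend on the mode, so the two
    products have different dependent types. This is dealt with by choosing a
    common bound [N] of all the ranks and padding every slice with zeros to an
    [N] x [N] matrix. Padding is multiplicative ([pad_mxM]), keeps the trace of
    a square matrix ([mxtrace_pad]) and does not see the identifications of
    equal dimensions ([mxtrace_cast_pad], [pad_mx_cast_col]).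
    Hence each entry of a tensor ring is the trace of an ordinary product of
    [N] x [N] matrices along the cycle of modes ([tensor_ringE]); shifting the
    cores only changes the mode at which this product starts, and the trace
    does not depend on that mode ([mxtrace_cycle]). *)

Set Implicit Arguments.
Unset Strict Implicit.
Unset Printing Implicit Defensive.

Import GRing.Theory.
Local Open Scope ring_scope.

#[local] Arguments ordS {n}.

Section Padding.

Variables (R : comNzRingType) (N : nat).

(** When [p, q <= N] this is the block matrix with [A] in the upper left corner
    and zeros elsewhere; the factored form makes multiplicativity a matter of
    associativity. *)
Definition pad_mx p q (A : 'M[R]_(p, q)) : 'M[R]_N :=
  (pid_mx p : 'M_(N, p)) *m A *m (pid_mx q : 'M_(q, N)).

Lemma mul_pid_mx_bound p :
  (p <= N)%N -> (pid_mx p : 'M[R]_(p, N)) *m (pid_mx p : 'M_(N, p)) = 1%:M.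
Proof.
by move=> le_pN; rewrite mul_pid_mx minnn (minn_idPr le_pN) pid_mx_1.
Qed.

Lemma pad_mxM p q s (A : 'M[R]_(p, q)) (B : 'M[R]_(q, s)) :
  (q <= N)%N -> pad_mx (A *m B) = pad_mx A * pad_mx B.
Proof.
move=> le_qN; rewrite -mulmxE /pad_mx -!mulmxA; congr (_ *m (_ *m _)).
by rewrite !mulmxA mul_pid_mx_bound // mul1mx.
Qed.

Lemma mxtrace_pad p (A : 'M[R]_p) : (p <= N)%N -> \tr (pad_mx A) = \tr A.
Proof.
by move=> le_pN; rewrite /pad_mx mxtrace_mulC mulmxA mul_pid_mx_bound ?mul1mx.
Qed.

Lemma mxtrace_cast_pad p q (e : q = p) (A : 'M[R]_(p, q)) :
  (p <= N)%N -> \tr (castmx (erefl, e) A) = \tr (pad_mx A).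
Proof. by case: p / e A => A le_qN; rewrite castmx_id mxtrace_pad. Qed.

Lemma pad_mx_cast_col p q q' (e : q' = q) (A : 'I_p -> 'I_q -> R) :
  pad_mx (\matrix_(a, b) A a (cast_ord e b)) = pad_mx (\matrix_(a, b) A a b).
Proof.
case: q / e A => A; congr pad_mx.
by apply/matrixP=> a b; rewrite !mxE cast_ord_id.
Qed.

End Padding.

(** Starting one mode later moves the first factor to the end of the product,
    because [d.+1] successor steps lead back to the initial mode. *)
Lemma mxtrace_cycle_succ (R : comNzRingType) N d (P : 'I_d.+1 -> 'M[R]_N) s :
  \tr (\prod_(m < d.+1) P (iter m ordS (ordS s)))
    = \tr (\prod_(m < d.+1) P (iter m ordS s)).
Proof.
rewrite big_ord_recr -iterSr iter_ordS_full mxtrace_mulC [in RHS]big_ord_recl.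
by congr (\tr (_ * _)); apply: eq_bigr => m _; rewrite -iterSr.
Qed.

Lemma mxtrace_cycle (R : comNzRingType) N d (P : 'I_d.+1 -> 'M[R]_N) k s :
  \tr (\prod_(m < d.+1) P (iter m ordS (iter k ordS s)))
    = \tr (\prod_(m < d.+1) P (iter m ordS s)).
Proof. by elim: k => //= k <-; apply: mxtrace_cycle_succ. Qed.

(** A nonempty chain is required: the empty one is an identity matrix, which
    is padded to a projection and not to the identity. *)
Lemma pad_chain_mx (R : realType) N d (r : 'I_d.+1 -> nat)
    (M : forall k, 'M[R]_(r k, r (ordS k))) m :
    (forall k, (r k <= N)%N) ->
  pad_mx N (chain_mx M m.+1)
    = \prod_(l < m.+1) pad_mx N (M (iter l ordS ord0)).
Proof.
move=> le_rN; elim: m => [|m IHm].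
  by rewrite big_ord_recl big_ord0 mulr1 /= mul1mx.
by rewrite big_ord_recr -IHm; apply: pad_mxM.
Qed.

Lemma tensor_ringE (R : realType) N d (r n : 'I_d.+1 -> nat)
    (Z : cores R r n) (i : mindex n) :
    (forall k, (r k <= N)%N) ->
  tensor_ring Z i = \tr (\prod_(m < d.+1)
    pad_mx N (slice (Z (iter m ordS ord0)) (i (iter m ordS ord0)))).
Proof.
by move=> le_rN; rewrite ffunE (mxtrace_cast_pad (N := N)) // pad_chain_mx.
Qed.

Lemma pad_slice_cshift (R : realType) N d (r n : 'I_d.+1 -> nat)
    (Z : cores R r n) k (i : mindex n) j :
  pad_mx N (slice (cshift_cores k Z j) (cshift_mindex k i j))
    = pad_mx N (slice (Z (iter k ordS j)) (i (iter k ordS j))).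
Proof. by rewrite ffunE; apply: pad_mx_cast_col. Qed.

Local Close Scope ring_scope.

Theorem theorem1 (R : realType) (d : nat) (n r : 'I_d.+1 -> nat)
    (T : tensor R n) (Z : cores R r n) (hT : T = tensor_ring Z)
    (k : nat) (hk : 1 <= k <= d) :
  cshift_tensor k T = tensor_ring (cshift_cores k Z).
Proof.
apply/ffunP => i'; rewrite -[i']uncshift_mindexK.
move: (uncshift_mindex i') => i; rewrite cshift_tensorE hT.
pose N := (\max_j r j)%N.
have le_rN j : (r j <= N)%N by apply: leq_bigmax.
rewrite (tensor_ringE _ _ le_rN) (tensor_ringE (N := N)); last first.
  by move=> j; apply: le_rN.
under [in RHS]eq_bigr do rewrite pad_slice_cshift.
pose P j := pad_mx N (slice (Z j) (i j)).
rewrite -(mxtrace_cycle P k); congr (\tr _)%R; apply: eq_bigr => m _.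
by rewrite /P -!iterD addnC.
Qed.
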